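(* Let $r>0$ and $E=\mathbb{R}\times\{0,r\}$ with the Euclidean distance $d$. Let $\widehat\Pi$ be a homogeneous Poisson process on $\mathbb{R}$ with rate $1$ and let $\Pi$ be the point process on $E$ consisting of a copy of the same realisation $\widehat\Pi$ on each line, i.e. $\Pi=\widehat\Pi\times\{0,r\}$. Let $(S_n)_{n\ge0}$ be the greedy walk on $\Pi$ starting from $S_0=(0,0)$. Then almost surely the greedy walk does not visit all points of $\Pi$. More precisely, almost surely the greedy walk visits all points of $\Pi$ on one side of the vertical line $\{0\}\times\mathbb{R}$ and finitely many points on the other side.
   Context: Greedy walk: given a simple point process $\Pi$ (viewed as a random set of points) in a metric space $(E,d)$ and a starting point $S_0\in E$, the greedy walk $(S_n)_{n\ge0}$ on $\Pi$ is defined recursively by $S_{n+1}=\arg\min\{d(X,S_n): X\in\Pi,\ X\notin\{S_0,S_1,\dots,S_n\}\}$. For the process considered here every step is almost surely uniquely defined. *)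

(* Defs.v *)
From HB Require Import structures.
From mathcomp Require Import all_boot all_order all_algebra.
From mathcomp Require Import all_classical all_reals all_analysis.
From mathcomp Require Import measurable_realfun.

Set Implicit Arguments.
Unset Strict Implicit.
Unset Printing Implicit Defensive.

Import Order.TTheory GRing.Theory Num.Theory.

Local Open Scope classical_set_scope.
Local Open Scope ring_scope.

(* The index set is the whole of 'I_n: the product rule for a subfamily is the
   case where the remaining [A i] are [setT]. *)
Definition mutually_independent d (T : measurableType d) (R : realType)
    (P : probability T R) (n : nat) (X : 'I_n -> T -> \bar R) : Prop :=
  forall A : 'I_n -> set (\bar R), (forall i, measurable (A i)) ->
    P (\bigcap_i (X i @^-1` A i)) = (\prod_(i < n) P (X i @^-1` A i))%E.

Definition npoints (T : Type) (R : realType) (Pi : T -> set R) (B : set R)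
    (w : T) : \bar R :=
  counting (Pi w `&` B).

(* Homogeneous Poisson process on the line, as a random set of points. Almost
   sure local finiteness follows from [pp_law] applied to bounded intervals.
   In [poisson_prob m 0%N], the argument [0%N] is a dummy: [poisson_prob m k]
   does not depend on [k]. It is the Dirac mass at 0 when [m = 0]. *)
Record poisson_process d (T : measurableType d) (R : realType)
    (P : probability T R) (rate : R) (Pi : T -> set R) : Prop := {
  pp_measurable : forall B : set R, measurable B ->
    measurable_fun setT (npoints Pi B) ;
  pp_law : forall B : set R, measurable B -> (lebesgue_measure B < +oo)%E ->
    forall U : set nat,
      P (npoints Pi B @^-1` [set k%:R%:E | k in U]) =
      poisson_prob (rate * fine (lebesgue_measure B)) 0%N U ;
  pp_independent : forall (n : nat) (B : 'I_n -> set R),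
    (forall i, measurable (B i)) -> trivIset setT B ->
    mutually_independent P (fun i => npoints Pi (B i)) }.

Section GreedyWalk.
Context (R : realType) (E : choiceType) (dist : E -> E -> R).

Definition argmin_dist (A : set E) (x : E) : set E :=
  [set y | A y /\ forall z, A z -> dist y x <= dist z x].

(* [:: S_n; ...; S_0]. When the minimiser is not unique, [xget] picks an
   unspecified one; when there is none, the walk stays where it is. *)
Fixpoint greedy_history (Pi : set E) (S0 : E) (n : nat) : seq E :=
  if n is m.+1 then
    let h := greedy_history Pi S0 m in
    let x := head S0 h in
    xget x (argmin_dist (Pi `\` [set` h]) x) :: h
  else [:: S0].

Definition greedy_walk (Pi : set E) (S0 : E) (n : nat) : E :=
  head S0 (greedy_history Pi S0 n).

Lemma greedy_walk0 Pi S0 : greedy_walk Pi S0 0 = S0.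
Proof. by []. Qed.

Lemma greedy_historyE Pi S0 n :
  [set` greedy_history Pi S0 n] =
  [set greedy_walk Pi S0 k | k in [set k | (k <= n)%N]].
Proof.
elim: n => [|n IHn].
  apply/seteqP; split => x /=; first by rewrite inE => /eqP ->; exists 0%N.
  by move=> [k]; rewrite leqn0 => /eqP -> <-; rewrite inE.
apply/seteqP; split => x /=.
  rewrite inE => /orP[/eqP ->|xh]; first by exists n.+1.
  have : [set` greedy_history Pi S0 n] x by [].
  by rewrite IHn => -[k /= kn <-]; exists k => //=; exact: leqW.
move=> [k]; rewrite leq_eqVlt ltnS => /orP[/eqP -> <-|kn kx].
  by rewrite inE eqxx.
have : [set` greedy_history Pi S0 n] x by rewrite IHn; exists k.
by rewrite /= inE => ->; rewrite orbT.
Qed.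

Lemma greedy_walkS Pi S0 n :
  greedy_walk Pi S0 n.+1 =
  xget (greedy_walk Pi S0 n)
    (argmin_dist
       (Pi `\` [set greedy_walk Pi S0 k | k in [set k | (k <= n)%N]])
       (greedy_walk Pi S0 n)).
Proof. by rewrite -greedy_historyE. Qed.

End GreedyWalk.

(* The library's own distance on [R * R] is the max distance. *)
Definition euclid_dist (R : realType) (x y : R * R) : R :=
  Num.sqrt ((x.1 - y.1) ^+ 2 + (x.2 - y.2) ^+ 2).

(* Main.v *)
Require Import Defs.
From HB Require Import structures.
From mathcomp Require Import all_boot all_order all_algebra.
From mathcomp Require Import all_classical all_reals all_analysis.
From mathcomp Require Import measurable_realfun.
From mathcomp Require Import lra zify.

Set Implicit Arguments.
Unset Strict Implicit.
Unset Printing Implicit Defensive.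

Import Order.TTheory GRing.Theory Num.Theory.

Local Open Scope classical_set_scope.
Local Open Scope ring_scope.

(** Fix a realisation [X] of the process and cut it at its gaps of length at
least [r]; call the pieces clumps. Almost surely no two points of [X] are at
distance exactly [r] ([ae_no_gap]), so that inside a clump consecutive points
are at distance less than [r], whereas different clumps are more than [r]
apart. Changing lines costs at least [r], with equality only for the step to
the twin of the current point.

The heart of the proof is that the walk visits both copies of a clump
completely before it leaves the clump ([sweeping_step], [clump_sweep]). As long
as the current line has an unvisited neighbour, a horizontal step shorter than
[r] is available. When there is none, the walk is at an end of the clump and
crosses to the twin; it runs through the whole other line, and if something was
left over on the first line it crosses back and finishes it. At every moment
before the end some unvisited point of the clump is within [r], so no step
leaves.

Hence at suitable times ([stage]) the visited set consists of both copies of a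
block of neighbouring clumps around the origin, and the walk is in the clump
that it entered last ([stage_step]). If that clump is the outermost one on its
side and the walk is at abscissa [c], then going back to the other side costs
at least [|c|], because everything between [0] and [c] has been visited. Going
forward is cheaper as soon as there are an empty gap of length [r] and a point
beyond it, both between [c] and [2 c] ([sparse]). So a walk that has gone far
enough out is committed to its side forever ([committed_step]): it visits all
points there and no further point on the other side
([committed_conclusion]). Local finiteness forces the walk to go far out, so
this does happen ([eventually_committed]); and since either side carries
infinitely many points, not all points are visited.

The probabilistic input is that [sparse] holds almost surely on both sides. The
half-line is divided into cells of length [r]; among [n] cells the event that
none is empty and the event that all are empty have geometrically decreasing
probabilities, and the Borel-Cantelli lemma applies ([ae_cells],
[cells_sparse]). *)

(** * Distances on two parallel lines *)

Section Distance.
Variables (R : realType) (r : R).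
Hypothesis r_gt0 : 0 < r.
Local Notation dist := (@euclid_dist R).

Lemma dist_same_line (x y l : R) : dist (x, l) (y, l) = `|x - y|.
Proof. by rewrite /euclid_dist /= subrr expr0n addr0 sqrtr_sqr. Qed.

Lemma dist_ge_horizontal (a b : R * R) : `|a.1 - b.1| <= dist a b.
Proof. by rewrite -sqrtr_sqr ler_wsqrtr// lerDl sqr_ge0. Qed.

Lemma line_gap_sqr (l m : R) : [set 0; r] l -> [set 0; r] m -> l != m ->
  (l - m) ^+ 2 = r ^+ 2.
Proof.
move=> [] -> [] ->; rewrite ?eqxx// => _.
  by rewrite sub0r sqrrN.
by rewrite subr0.
Qed.

Lemma dist_twin (x l m : R) : [set 0; r] l -> [set 0; r] m -> l != m ->
  dist (x, l) (x, m) = r.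
Proof.
move=> hl hm lm; rewrite /euclid_dist /= subrr expr0n add0r line_gap_sqr//.
by rewrite sqrtr_sqr gtr0_norm.
Qed.

Lemma dist_cross (a b : R * R) : [set 0; r] a.2 -> [set 0; r] b.2 ->
  a.2 != b.2 -> r <= dist a b /\ (dist a b <= r -> a.1 = b.1).
Proof.
move=> ha hb ab; rewrite /euclid_dist (line_gap_sqr ha hb ab).
have s0 := sqr_ge0 (a.1 - b.1); split.
  by rewrite -{1}(gtr0_norm r_gt0) -sqrtr_sqr ler_wsqrtr// lerDr.
rewrite -{2}(gtr0_norm r_gt0) -sqrtr_sqr ler_sqrt ?sqr_ge0//.
rewrite gerDr => s1; apply/eqP; rewrite -subr_eq0 -sqrf_eq0.
by apply/eqP; lra.
Qed.

End Distance.

(** * Clumps *)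

Section Linked.
Variables (R : realType) (r : R) (X : set R).
Hypothesis r_gt0 : 0 < r.

Definition empty_gap (t : R) := forall z, X z -> t < z -> z < t + r -> False.

(** Two reals are linked when no empty gap of length [r] separates them; the two
halves of the conjunction are the cases [x <= y] and [y <= x]. *)
Definition linked (x y : R) := forall t, empty_gap t ->
  (x <= t -> y < t + r) /\ (y <= t -> x < t + r).

Lemma linked_refl x : linked x x.
Proof. by have r0 := r_gt0; move=> t _; split=> ?; lra. Qed.

Lemma linked_sym x y : linked x y -> linked y x.
Proof. by move=> h t /h[]. Qed.

Lemma linked_trans y x z : X y -> linked x y -> linked y z -> linked x z.
Proof.
move=> Xy xy yz t vt; have [xy1 xy2] := xy t vt; have [yz1 yz2] := yz t vt.
have vy := vt _ Xy.
split => [/xy1 ytr|/yz2 ytr].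
  by case: (ltP t y) => [ty|/yz1//]; case: (vy ty).
by case: (ltP t y) => [ty|/xy2//]; case: (vy ty).
Qed.

Lemma linked_between x y z : linked x z ->
  (x <= y /\ y <= z) \/ (z <= y /\ y <= x) -> linked x y.
Proof.
move=> xz h t /xz[h1 h2]; case: h => -[? ?]; split => ht;
  by [lra | have := h1 ltac:(lra); lra | have := h2 ltac:(lra); lra].
Qed.

Hypothesis no_gap_r : forall x y, X x -> X y -> x + r <> y.

(** The separating gap is at least [r] long, and its length cannot be [r]. Strict
inequality makes a step of length [r] inside a clump cheaper than leaving it. *)
Lemma unlinked_far x y : X x -> X y -> ~ linked x y -> r < `|x - y|.
Proof.
move=> Xx Xy nxy; rewrite ltNge; apply/negP => xy; apply: nxy => t vt.
have nx := no_gap_r Xx Xy; have ny := no_gap_r Xy Xx.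
have := vt _ Xx; have := vt _ Xy; rewrite ler_norml in xy.
move/andP: xy => [h1 h2] vy vx.
split => ht; rewrite ltNge; apply/negP => ht'.
  apply: nx; apply/eqP; rewrite eq_le; apply/andP; split; lra.
apply: ny; apply/eqP; rewrite eq_le; apply/andP; split; lra.
Qed.

(** The open interval of length [r] that starts at [x] in the direction of [y] is
not an empty gap, since it would separate [x] from [y]. The sign [s] gives the
direction; the same convention is used for the two sides of the origin. *)
Lemma linked_next s x y : s = 1 \/ s = -1 -> X x -> X y -> linked x y ->
  s * x < s * y ->
  exists z, [/\ X z, linked x z, s * x < s * z, s * z < s * x + r &
    s * z <= s * y].
Proof.
have r0 := r_gt0.
move=> sP Xx Xy xy sxy.
case: (ltP (s * y) (s * x + r)) => hy; first by exists y; split.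
have [t [nvt ht]] : exists t, ~ empty_gap t /\
    (forall z, t < z -> z < t + r -> s * x < s * z /\ s * z < s * x + r).
  case: sP hy => -> hy; [exists x|exists (x - r)]; split.
  - by move=> /xy[h _]; have := h (lexx x); lra.
  - by move=> z *; split; lra.
  - by move=> /xy[_ h]; have := h ltac:(lra); lra.
  - by move=> z *; split; lra.
move: nvt => /existsNP[z /not_implyP[Xz /not_implyP[h1 /not_implyP[h2 _]]]].
have [h3 h4] := ht z h1 h2.
exists z; split => //; last lra.
by apply: (linked_between xy); case: sP h3 h4 hy => ->; lra.
Qed.

End Linked.

Definition visited (E : Type) (S : nat -> E) (n : nat) : set E :=
  [set S k | k in [set k | (k <= n)%N]].

Lemma visitedS (E : Type) (S : nat -> E) n a :
  visited S n.+1 a <-> visited S n a \/ a = S n.+1.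
Proof.
split=> [[k /= kn <-]|[[k /= kn <-]|->]].
- move: kn; rewrite leq_eqVlt => /orP[/eqP ->|kn]; first by right.
  by left; exists k.
- by exists k => //=; exact: leqW.
- by exists n.+1 => /=.
Qed.

(** * The walk inside a clump *)

Section Clump.
Variables (R : realType) (r : R) (X : set R) (S : nat -> R * R).
Hypothesis r_gt0 : 0 < r.
Hypothesis no_gap_r : forall x y, X x -> X y -> x + r <> y.
Hypothesis greedy : forall n,
  argmin_dist (@euclid_dist R) ((X `*` [set 0; r]) `\` visited S n)
    (S n) (S n.+1).
Local Notation dist := (@euclid_dist R).
Local Notation V := (visited S).

Lemma line_other (y l : R) : [set 0; r] y -> [set 0; r] l -> l != y -> l = r - y.
Proof. by move=> [] -> [] ->; rewrite ?eqxx// ?subr0 ?subrr. Qed.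

Lemma line_opp (y : R) : [set 0; r] y -> [set 0; r] (r - y).
Proof. by case=> ->; rewrite ?subr0 ?subrr; [right|left]. Qed.

Lemma line_opp_neq (y : R) : [set 0; r] y -> y != r - y.
Proof.
have r0 := r_gt0.
by case=> ->; rewrite ?subr0 ?subrr; apply/eqP; lra.
Qed.

Lemma next_mem n : X (S n.+1).1 /\ [set 0; r] (S n.+1).2.
Proof. by have [[[? ?] _] _] := greedy n. Qed.

Lemma next_fresh n : ~ V n (S n.+1).
Proof. by have [[_ ?] _] := greedy n. Qed.

Lemma next_nearest n x l : X x -> [set 0; r] l -> ~ V n (x, l) ->
  dist (S n.+1) (S n) <= dist (x, l) (S n).
Proof. by move=> Xx hl nV; have [_] := greedy n; apply. Qed.

Definition clump (p : R) : set R := [set x | X x /\ linked r X p x].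

(** The walk has used only one line of the clump: what it has visited there is a
run of consecutive points, and the walk is at an end of this run. *)
Definition one_line p n := exists a b,
  [/\ (S n).1 = a \/ (S n).1 = b, a <= b,
   (forall x, clump p x -> (V n (x, (S n).2) <-> a <= x /\ x <= b)) &
   forall x, clump p x -> ~ V n (x, r - (S n).2)].

(** The walk moves in the direction [s], and the points ahead of it on its line are
unvisited, up to [e] if [f] holds. As long as [f] fails, the other line still
has its points beyond [b] to be visited; this is the first crossing of the
clump on the second line. [f] holds on the way back to the leftovers of the
first line. *)
Definition one_way p n := exists s (f : Prop) b e,
  [/\ s = 1 \/ s = -1,
   (forall x, clump p x -> (V n (x, (S n).2) <->
      ~ (s * (S n).1 < s * x /\ (f -> s * x < s * e)))) &
   forall x, clump p x -> (V n (x, r - (S n).2) <-> f \/ s * x <= s * b)].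

Definition sweeping p n :=
  [/\ clump p (S n).1, [set 0; r] (S n).2 & one_line p n \/ one_way p n].

(** If the current line has an unvisited point nearer than [r], the step must be
horizontal, and going to the nearest point keeps the shape of the visited set.
Otherwise the walk is at an end of the clump and its twin is
unvisited: the twin is at distance [r], any other point of the other line is
farther, and so are the points outside the clump. *)
Lemma sweeping_step p n : X p -> sweeping p n ->
  (exists x l, [/\ clump p x, [set 0; r] l & ~ V n (x, l)]) ->
  sweeping p n.+1.
Proof.
have r0 := r_gt0.
move=> Xp [Cc hy hn] [x1 [l1 [Cx1 hl1 nV1]]].
have [Xc' hy'] := next_mem n.
have nV' := @next_fresh n.
have nearest := @next_nearest n.
have visS := @visitedS _ S n.
rewrite /sweeping /one_line /one_way in hn *.
case ES : (S n) hn Cc hy nearest => [c y] /= hn Cc hy nearest.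
case ES' : (S n.+1) Xc' hy' nV' nearest visS => [c' y'] /=
  Xc' hy' nV' nearest visS.
have [Xc pc] := Cc.
have yy : y != r - y by exact: line_opp_neq.
have hyo : [set 0; r] (r - y) by exact: line_opp.
have in_clump : dist (c', y') (c, y) <= r -> clump p c'.
  move=> Dr; split=> //; apply: contrapT => npc'.
  have ncc' : ~ linked r X c' c.
    by move=> c'c; apply: npc'; apply: (linked_trans Xc pc); exact: linked_sym.
  have := unlinked_far no_gap_r Xc' Xc ncc'.
  have /= := dist_ge_horizontal (c', y') (c, y); lra.
have cross : y' != y -> r <= dist (c', y') (c, y) /\
    (dist (c', y') (c, y) <= r -> c' = c /\ y' = r - y).
  move=> y'y; have [h1 /= h2] := @dist_cross _ _ r_gt0 (c', y') (c, y) hy' hy y'y.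
  by split=> // /h2 ->; split=> //; exact: line_other.
have near_same z : X z -> ~ V n (z, y) -> dist (c', y') (c, y) <= `|z - c|.
  by move=> Xz nVz; rewrite -(dist_same_line z c y); exact: nearest.
have twin : ~ V n (c, r - y) -> dist (c', y') (c, y) <= r.
  move=> nVc; rewrite -(dist_twin r_gt0 c hyo hy); first exact: nearest.
  by rewrite eq_sym.
have vis_y x : y' = y -> (V n.+1 (x, y) <-> V n (x, y) \/ x = c').
  by move=> <-; rewrite visS; split=> -[]; try (by left);
    [case=> ->; right|move=> ->; right].
have vis_yo x : y' = y -> (V n.+1 (x, r - y) <-> V n (x, r - y)).
  move=> ey; rewrite visS ey; split=> [[]//|]; last by left.
  by case=> _ e; rewrite e eqxx in yy.
have vis_x x : y' = r - y -> (V n.+1 (x, r - y) <-> V n (x, r - y) \/ x = c').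
  by move=> <-; rewrite visS; split=> -[]; try (by left);
    [case=> ->; right|move=> ->; right].
have vis_xo x : y' = r - y -> (V n.+1 (x, y) <-> V n (x, y)).
  move=> ey; rewrite visS ey; split=> [[]//|]; last by left.
  by case=> _ e; rewrite -e eqxx in yy.
(* While only one line has been used, the twin is unvisited. *)
case: hn => [[a [b [cab ab vy vo]]]|[s [f [b [e [sP vy vo]]]]]].
  have Dr := twin (vo _ Cc).
  have Cc' := in_clump Dr.
  split => //.
  have [ey|ney] := eqVneq y' y.
    left; rewrite ey; rewrite ey in nV'.
    have c'ab : ~ (a <= c' /\ c' <= b) by move=> h; apply: nV'; apply/vy.
    have vo' x : clump p x -> ~ V n.+1 (x, r - y).
      by move=> Cx; rewrite vis_yo//; exact: vo.
    have gap x : clump p x -> ~ (a <= x /\ x <= b) -> `|c' - c| <= `|x - c|.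
      move=> Cx xab; have := near_same x Cx.1.
      by rewrite ey dist_same_line; apply => /(vy _ Cx)/xab.
    have [c'a|ac'] := ltP c' a.
      exists c', b; split; [by left|lra| |exact: vo'].
      move=> x Cx; rewrite vis_y// vy//; split=> [[]|]; try lra.
      move=> [c'x xb]; have [ax|xa] := leP a x; first by left.
      right; have := gap _ Cx ltac:(lra).
      by case: cab => ?; rewrite !ler0_norm; lra.
    have bc' : b < c' by rewrite ltNge; apply/negP; lra.
    exists a, c'; split; [by right|lra| |exact: vo'].
    move=> x Cx; rewrite vis_y// vy//; split=> [[]|]; try lra.
    move=> [c'x xb]; have [ax|xa] := leP x b; first by left.
    right; have := gap _ Cx ltac:(lra).
    by case: cab => ?; rewrite !ger0_norm; lra.
  have [Dr' /(_ Dr)[ec' ey]] := cross ney.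
  have noclose z : clump p z -> ~ (a <= z /\ z <= b) -> `|z - c| < r -> False.
    by move=> Cz zab; have := near_same z Cz.1; rewrite vy// => /(_ zab); lra.
  right.
  (* After the crossing, the direction [s] points from the end [c] into the clump,
     and [m] is the other end of the run visited on the first line. *)
  have main s m : s = 1 \/ s = -1 -> (forall x, clump p x -> s * c <= s * x) ->
      (forall x, s * c <= s * x -> (a <= x /\ x <= b <-> s * x <= s * m)) ->
    exists (s : R) (f : Prop) (b e : R),
    [/\ s = 1 \/ s = -1,
     (forall x, clump p x -> (V n.+1 (x, y') <->
        ~ (s * c' < s * x /\ (f -> s * x < s * e)))) &
     forall x, clump p x -> (V n.+1 (x, r - y') <-> f \/ s * x <= s * b)].
    move=> sP endc hm; exists s, False, m, 0; split=> // x Cx; have xc := endc _ Cx.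
      rewrite ey vis_x// ec'; split=> [[/vo//|->]|]; first by rewrite ltxx => -[].
      move=> h; right; apply/eqP; rewrite eq_le; apply/andP.
      have : ~ (s * c < s * x) by move=> h'; apply: h.
      by move/negP; rewrite -leNgt; case: sP xc => ->; lra.
    rewrite ey (_ : r - (r - y) = y); last lra.
    by rewrite vis_xo// vy// hm//; split=> [|[]//]; right.
  case: cab => ca.
    apply: (main 1 b) => [|x Cx|x]; [by left| |lra].
    rewrite leNgt; apply/negP => xc.
    have sP : (-1 : R) = 1 \/ (-1 : R) = -1 by right.
    have cx : linked r X c x.
      exact: (linked_trans Xp (linked_sym pc) Cx.2).
    have [z [Xz cz z1 z2 _]] := linked_next r_gt0 sP Xc Cx.1 cx ltac:(lra).
    apply: (noclose z); [|lra|by rewrite ltr_norml; lra].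
    by split=> //; exact: (linked_trans Xc pc cz).
  apply: (main (-1) a) => [|x Cx|x]; [by right| |lra].
  rewrite leNgt; apply/negP => xc.
  have sP : (1 : R) = 1 \/ (1 : R) = -1 by left.
  have cx : linked r X c x.
    exact: (linked_trans Xp (linked_sym pc) Cx.2).
  have [z [Xz cz z1 z2 _]] := linked_next r_gt0 sP Xc Cx.1 cx ltac:(lra).
  apply: (noclose z); [|lra|by rewrite ltr_norml; lra].
  by split=> //; exact: (linked_trans Xc pc cz).
have [[x [Cx nVx]]|allV] := pselect (exists x, clump p x /\ ~ V n (x, y)).
  have [cx xe] : s * c < s * x /\ (f -> s * x < s * e).
    by apply: contrapT => h; apply: nVx; rewrite vy.
  have [z [Xz cz z1 z2 z3]] := linked_next r_gt0 sP Xc Cx.1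
    (linked_trans Xp (linked_sym pc) Cx.2) cx.
  have Cz : clump p z by split=> //; exact: (linked_trans Xc pc cz).
  have nVz : ~ V n (z, y).
    by rewrite vy//; apply; split=> // /xe; lra.
  have Dz : dist (c', y') (c, y) < r.
    apply: le_lt_trans (near_same _ Xz nVz) _.
    by rewrite ltr_norml; case: sP z1 z2 => ->; lra.
  have ey : y' = y.
    by apply/eqP; apply: contrapT => /negP/cross[]; lra.
  have Cc' := in_clump (ltW Dz).
  split=> //; right; exists s, f, b, e; rewrite ey in nV' *.
  have [cc' c'e] : s * c < s * c' /\ (f -> s * c' < s * e).
    by apply: contrapT => h; apply: nV'; rewrite vy.
  split=> // x' Cx'; last by rewrite vis_yo// vo.
  rewrite vis_y// vy//; split.
    by case=> [h [h1 h2]|->]; [apply: h; split=> //; lra|rewrite ltxx => -[]].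
  move=> h; have [->|x'c'] := eqVneq x' c'; [by right|left].
  move=> [cx' x'e]; apply: h; split=> //.
  have nVx' : ~ V n (x', y) by rewrite vy//; apply.
  have := near_same _ Cx'.1 nVx'; rewrite ey dist_same_line => D'.
  rewrite lt_neqAle; apply/andP; split.
    apply: contraNneq x'c'; case: sP => ->; rewrite ?mul1r ?mulN1r.
      by move=> ->.
    by move=> /oppr_inj ->.
  by move: D' cc' cx'; case: sP => -> D' cc' cx';
    [rewrite !ger0_norm in D'|rewrite !ler0_norm in D']; lra.
have Vy x : clump p x -> V n (x, y).
  by move=> Cx; apply: contrapT => nV; apply: allV; exists x.
(* The current line is exhausted, hence the other one is not: the walk is at the
   end of the clump, where the twin is unvisited, and it turns back. *)
have nV1' : ~ V n (x1, r - y).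
  have [e1|ne1] := eqVneq l1 y; first by rewrite e1 in nV1; case: (nV1 (Vy _ Cx1)).
  by rewrite -(line_other hy hl1 ne1).
have nf : ~ f by move=> hf; apply: nV1'; rewrite vo//; left.
have endc x : clump p x -> s * x <= s * c.
  move=> Cx; rewrite leNgt; apply/negP => cx.
  by have /vy := Vy _ Cx; apply.
have bx1 : s * b < s * x1.
  by rewrite ltNge; apply/negP => h; apply: nV1'; rewrite vo//; right.
have x1c := endc _ Cx1.
have Dr : dist (c', y') (c, y) <= r.
  by apply: twin; rewrite vo// => -[//|]; lra.
have Cc' := in_clump Dr.
have ney : y' != y by apply/eqP => ey; apply: nV'; rewrite ey; exact: Vy.
have [_ /(_ Dr)[ec' ey]] := cross ney.
split=> //; right; exists (- s), True, 0, b; split=> [|x Cx|x Cx].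
- by case: sP => ->; [right|left; rewrite opprK].
- have xc := endc _ Cx.
  rewrite ey vis_x// ec' vo//; split.
    case=> [[//|xb] [h1 /(_ I)]|->]; first by lra.
    by rewrite ltxx => -[].
  move=> h; have [xb|bx] := leP (s * x) (s * b); first by left; right.
  right; apply/eqP; rewrite eq_le; apply/andP.
  have [cx|cx] := ltP (s * x) (s * c).
    by exfalso; apply: h; split=> [|_]; lra.
  by case: sP xc cx => ->; lra.
- rewrite ey (_ : r - (r - y) = y); last lra.
  by rewrite vis_xo//; split=> _; [left|exact: Vy].
Qed.

End Clump.

(** * The walk from clump to clump *)

(** An empty gap of length [r] and a point behind it are met on the way from [c] to
[2 c]; [~ linked r X c u] provides the gap. *)
Definition sparse (R : realType) (r : R) (X : set R) (s K : R) : Prop :=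
  forall c, K <= s * c ->
    exists u, [/\ X u, s * c < s * u, s * u < 2 * (s * c) & ~ linked r X c u].

Section Walk.
Variables (R : realType) (r : R) (X : set R) (S : nat -> R * R).
Hypothesis r_gt0 : 0 < r.
Hypothesis no_gap_r : forall x y, X x -> X y -> x + r <> y.
Hypothesis X_locfin : forall M : R, finite_set (X `&` [set x | `|x| <= M]).
Hypothesis X_n0 : ~ X 0.
Variables Kright Kleft : R.
Hypothesis Kright_gt0 : 0 < Kright.
Hypothesis Kleft_gt0 : 0 < Kleft.
Hypothesis sparse_right : sparse r X 1 Kright.
Hypothesis sparse_left : sparse r X (-1) Kleft.
Hypothesis start : S 0%N = (0, 0).
Hypothesis greedy : forall n,
  argmin_dist (@euclid_dist R) ((X `*` [set 0; r]) `\` visited S n)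
    (S n) (S n.+1).
Local Notation dist := (@euclid_dist R).
Local Notation V := (visited S).
Local Notation clump := (@clump R r X).

Lemma walk_inj : injective S.
Proof.
suff lt_neq i j : (i < j)%N -> S i <> S j.
  move=> i j ij; have [lij|lji|//] := ltngtP i j.
    by case: (lt_neq _ _ lij).
  by case: (lt_neq _ _ lji).
case: j => // j; rewrite ltnS => ij e.
by apply: (next_fresh greedy (n := j)); rewrite -e; exists i.
Qed.

Lemma line0 : [set 0; r] (0 : R). Proof. by left. Qed.

Lemma walk_mem n : (0 < n)%N -> X (S n).1 /\ [set 0; r] (S n).2.
Proof. by case: n => // n _; exact: next_mem. Qed.

(** The steps are distinct points, and a bounded part of [X] is finite. *)
Lemma walk_escapes (M : R) : exists m, forall n, (m <= n)%N -> M < `|(S n).1|.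
Proof.
have : finite_set (S @^-1` ((0, 0) |` ((X `&` [set x | `|x| <= M]) `*` [set 0; r]))).
  apply: finite_preimage; first by move=> i j _ _; exact: walk_inj.
  rewrite finite_setU; split; first exact: finite_set1.
  by apply: finite_setX; [exact: X_locfin|exact: finite_set2].
move=> /finite_seqP[A eA].
exists (\max_(i <- A) i).+1 => n mn; rewrite ltNge; apply/negP => nM.
have : [set` A] n.
  rewrite -eA /=; case: n mn nM => [|n] mn nM; first by left.
  by right; have [Xn ln] := next_mem greedy n; split.
move=> /= An; have := @leq_bigmax_seq _ A xpredT (fun i => i) n An isT.
by rewrite leqNgt mn.
Qed.

Lemma clump_bounded_side (s K p : R) : s = 1 \/ s = -1 -> sparse r X s K ->
  exists M, forall x, clump p x -> s * x <= M.
Proof.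
move=> sP sp; pose c := s * Num.max K (s * p).
have sc : s * c = Num.max K (s * p).
  by rewrite /c mulrA; case: sP => ->; rewrite ?mulrNN mulr1 mul1r.
have [u [Xu cu _ ncu]] := sp c ltac:(by rewrite sc le_max lexx).
have pc : s * p <= s * c by rewrite sc le_max lexx orbT.
exists (s * u) => x [Xx px]; rewrite leNgt; apply/negP => ux.
apply: ncu; apply: linked_sym; apply: (@linked_between _ _ _ _ _ p).
  apply: linked_sym; apply: (linked_between px).
  by case: sP pc cu ux => ->; lra.
by case: sP pc cu ux => ->; lra.
Qed.

Lemma clump_bounded (p : R) : exists M, forall x, clump p x -> `|x| <= M.
Proof.
have [M1 h1] := clump_bounded_side p (or_introl erefl) sparse_right.
have [M2 h2] := clump_bounded_side p (or_intror erefl) sparse_left.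
exists (Num.max M1 M2) => x Cx; rewrite ler_norml.
have := h1 _ Cx; have := h2 _ Cx.
have : M1 <= Num.max M1 M2 by rewrite le_max lexx.
have : M2 <= Num.max M1 M2 by rewrite le_max lexx orbT.
lra.
Qed.

(** A clump is bounded whereas the walk leaves every bounded set, so the steps of
[sweeping_step] cannot go on forever. *)
Lemma clump_sweep p n : X p -> sweeping r X S p n ->
  exists n', [/\ (n <= n')%N,
    (forall x l, clump p x -> [set 0; r] l -> V n' (x, l)) &
    forall k, (n <= k <= n')%N -> clump p (S k).1].
Proof.
move=> Xp swn; apply: contrapT => notdone.
have all m : forall k, (n <= k <= n + m)%N -> sweeping r X S p k.
  elim: m => [|m IHm] k.
    by rewrite addn0 -eqn_leq => /eqP <-.
  move=> /andP[nk]; rewrite leq_eqVlt addnS ltnS => /orP[/eqP ->|km]; last first.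
    by apply: IHm; rewrite nk.
  have swm : sweeping r X S p (n + m) by apply: IHm; lia.
  apply: sweeping_step => //; apply: contrapT => alldone.
  apply: notdone; exists (n + m)%N; split; [lia| |].
    by move=> x l Cx hl; apply: contrapT => nV; apply: alldone; exists x, l.
  by move=> j /IHm[].
have [M CM] := clump_bounded p; have [m mM] := walk_escapes M.
have [Cc _ _] := all m (n + m)%N ltac:(lia).
by have := mM (n + m)%N ltac:(lia); rewrite ltNge CM.
Qed.

(** The origin counts as reached: the block of visited clumps grows around it. *)
Definition reached n (x : R) := x = 0 \/ X x /\ V n (x, 0).

(** The walk has just completed a clump: the visited abscissae are the same on both
lines, they form a union of clumps, and no point of [X] is left out between two
reached abscissae. *)
Definition stage n :=
  [/\ reached n (S n).1, [set 0; r] (S n).2,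
   (forall x l, X x -> [set 0; r] l -> (V n (x, l) <-> V n (x, 0))),
   (forall x y, X x -> X y -> V n (x, 0) -> linked r X x y -> V n (y, 0)) &
   (forall x y z, reached n x -> reached n z -> X y -> x < y -> y < z ->
      V n (y, 0))].

Lemma stage0 : stage 0.
Proof.
have V0 x l : X x -> V 0 (x, l) -> False.
  move=> Xx [k /=]; rewrite leqn0 => /eqP ->; rewrite start => -[x0 _].
  by rewrite -x0 in Xx.
have r0 x : reached 0 x -> x = 0 by case=> // -[Xx /(V0 _ _ Xx)].
split; rewrite ?start; [by left|by left| | |].
- by move=> x l Xx hl; split => /(V0 _ _ Xx).
- by move=> x y Xx _ /(V0 _ _ Xx).
- by move=> x y z /r0 -> /r0 -> _ xy yx; have := lt_trans xy yx; rewrite ltxx.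
Qed.

Lemma stage_next n : stage n -> X (S n.+1).1 /\ ~ V n ((S n.+1).1, 0).
Proof.
case=> _ _ lines _ _; have [Xq lq] := next_mem greedy n; split=> //.
by rewrite -(lines _ _ Xq lq) -surjective_pairing; exact: next_fresh.
Qed.

Lemma stage_nearest n (u : R) : stage n -> X u -> ~ V n (u, 0) ->
  `|(S n.+1).1 - (S n).1| <= `|u - (S n).1|.
Proof.
case=> _ ln lines _ _ Xu nVu; apply: le_trans (dist_ge_horizontal _ _) _.
rewrite -(dist_same_line _ _ (S n).2) -surjective_pairing.
by apply: (next_nearest greedy) => //; rewrite lines.
Qed.

Lemma visited_after n n' a : (n <= n')%N -> V n' a <->
  V n a \/ exists2 k, (n < k <= n')%N & S k = a.
Proof.
move=> nn'; split=> [[k /= kn' <-]|[[k /= kn <-]|[k /andP[nk kn'] <-]]].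
- have [kn|nk] := leqP k n; first by left; exists k.
  by right; exists k => //; rewrite nk.
- by exists k => //=; exact: leq_trans nn'.
- by exists k.
Qed.

(** The nearest unvisited point lies in a fresh clump, which is swept next. No
unvisited point lies between the current position and this clump, since it would
have been nearer; hence the visited block stays free of holes. *)
Lemma stage_step n : stage n -> exists n', [/\ (n < n')%N, stage n',
  (forall k, (n < k <= n')%N -> clump (S n.+1).1 (S k).1) &
  (forall x, X x -> (V n' (x, 0) <-> V n (x, 0) \/ linked r X (S n.+1).1 x))].
Proof.
move=> stn; have [Xq nVq] := stage_next stn; have nearest := stage_nearest stn.
case: stn => hc ln lines sat conv.
have lq := (next_mem greedy n).2.
move: Xq nVq lq nearest; set q := (S n.+1).1 => Xq nVq lq nearest.
have fresh x l : clump q x -> [set 0; r] l -> ~ V n (x, l).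
  move=> [Xx qx] hl; rewrite lines// => Vx; apply: nVq.
  by apply: (sat x q) => //; exact: linked_sym.
have Cq : clump q q by split=> //; exact: linked_refl.
have sw : sweeping r X S q n.+1.
  split=> //; left; exists q, q; split=> //; first by left.
    move=> x Cx; rewrite visitedS; split=> [[/(fresh _ _ Cx lq)//|]|[qx xq]].
      by rewrite /q => <-.
    right; rewrite [RHS]surjective_pairing; congr (_, _).
    by apply/eqP; rewrite eq_le xq.
  move=> x Cx; have lq' := line_opp lq.
  rewrite visitedS => -[|]; first exact: fresh.
  move=> /(congr1 snd)/= e.
  by have := line_opp_neq r_gt0 lq; rewrite e eqxx.
have [n' [nn' all inC]] := clump_sweep Xq sw.
have Vn' x l : X x -> [set 0; r] l ->
    (V n' (x, l) <-> V n (x, l) \/ linked r X q x).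
  move=> Xx hl; rewrite (visited_after _ (ltnW nn')); split.
    case=> [|[k /inC Ck ek]]; first by left.
    by right; rewrite ek in Ck; exact: Ck.2.
  case=> [|qx]; first by left.
  have Cx : clump q x by [].
  have /(visited_after _ (ltnW nn'))[] := all x l Cx hl; first by move=> ?; left.
  by move=> ?; right.
exists n'; split => //; last by move=> x Xx; exact: Vn' line0.
have := inC n'; rewrite leqnn nn' => /(_ isT) Cc'.
have Vc' : V n' ((S n').1, 0) by apply/(Vn' _ _ Cc'.1 line0); right; exact: Cc'.2.
split.
- by right; split=> //; exact: Cc'.1.
- by case: n' nn' {all inC Vn' Cc' Vc'} => // m _; exact: (next_mem greedy m).2.
- by move=> x l Xx hl; rewrite (Vn' _ _ Xx hl) (Vn' _ _ Xx line0) lines.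
- move=> x y Xx Xy; rewrite (Vn' _ _ Xx line0) (Vn' _ _ Xy line0).
  move=> -[Vx|qx] xy; first by left; exact: sat xy.
  by right; exact: linked_trans xy.
- have between y : X y -> ((S n).1 < y /\ y < q) \/ (q < y /\ y < (S n).1) ->
      V n (y, 0).
    move=> Xy hy; apply: contrapT => /(nearest _ Xy).
    case: hy => -[? ?]; [rewrite !ger0_norm|rewrite !ler0_norm]; lra.
  have reached' x : reached n' x -> reached n x \/ clump q x.
    move=> [->|[Xx /(Vn' _ _ Xx line0)[Vx|qx]]]; [by left; left| |by right].
    by left; right.
  have onc : X (S n).1 -> V n ((S n).1, 0).
    by case: hc => [->|[]].
  move=> x y z hx hz Xy xy yz; apply/(Vn' _ _ Xy line0).
  case: (reached' _ hx) => [Rx|Cx]; case: (reached' _ hz) => [Rz|Cz].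
  + by left; exact: (conv x y z).
  + have [yc|cy|yc] := ltgtP y (S n).1; [|
      |by left; rewrite yc; apply: onc; rewrite -yc].
    * by left; exact: (conv x y (S n).1).
    * have [yq|qy|->] := ltgtP y q; last by right; exact: Cq.2.
      - by left; apply: between => //; left.
      - by right; apply: (linked_between Cz.2); left; split; exact: ltW.
  + have [yc|cy|yc] := ltgtP y (S n).1; [|
      |by left; rewrite yc; apply: onc; rewrite -yc].
    * have [yq|qy|->] := ltgtP y q; last by right; exact: Cq.2.
      - by right; apply: (linked_between Cx.2); right; split; exact: ltW.
      - by left; apply: between => //; right.
    * by left; exact: (conv (S n).1 y z).
  + right; have [yq|qy] := leP y q.
      by apply: (linked_between Cx.2); right; split=> //; exact: ltW.
    by apply: (linked_between Cz.2); left; split; exact: ltW.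
Qed.

Lemma stage_ge m : exists2 n, (m <= n)%N & stage n.
Proof.
elim: m => [|m [n mn stn]]; first by exists 0%N => //; exact: stage0.
have [n' [nn' stn' _ _]] := stage_step stn.
by exists n' => //; exact: leq_ltn_trans nn'.
Qed.

(** The current clump is the outermost visited one on the side [s]. *)
Definition frontier (s : R) n :=
  forall x, X x -> V n (x, 0) -> s * (S n).1 < s * x -> linked r X (S n).1 x.

(** Clumps are the traces of disjoint intervals, and the current position belongs to
a completed clump, which the fresh one cannot straddle. *)
Lemma outward_clump (s : R) n x : s = 1 \/ s = -1 -> stage n -> X (S n).1 ->
  s * (S n).1 < s * (S n.+1).1 -> clump (S n.+1).1 x -> s * (S n).1 < s * x.
Proof.
move=> sP stn Xc cq [Xx qx]; rewrite ltNge; apply/negP => xc.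
have [Xq nVq] := stage_next stn; case: stn => hc _ _ sat _; apply: nVq.
apply: (sat (S n).1) => //; first by case: hc => [c0|[]//]; rewrite c0 in Xc.
apply: linked_sym; apply: (linked_between qx).
by case: sP cq xc => ->; lra.
Qed.

(** An abscissa reached earlier and lying beyond the fresh clump would put the
unvisited point [S n.+1] between two reached abscissae. *)
Lemma outward_frontier (s : R) n n' : s = 1 \/ s = -1 -> stage n ->
  s * (S n).1 < s * (S n.+1).1 -> clump (S n.+1).1 (S n').1 ->
  (forall x, X x -> (V n' (x, 0) <-> V n (x, 0) \/ linked r X (S n.+1).1 x)) ->
  frontier s n'.
Proof.
move=> sP stn cq [Xc' qc'] Vn' x Xx /(Vn' _ Xx) Vx c'x.
have [Xq nVq] := stage_next stn.
have c'q := linked_sym qc'.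
case: Vx => [Vx|]; last exact: linked_trans.
have [hc _ _ _ conv] := stn.
have hx : reached n x by right.
have xq : s * x <= s * (S n.+1).1.
  rewrite leNgt; apply/negP => qx; apply: nVq.
  by case: sP cq qx => -> cq qx; [apply: (conv (S n).1 _ x)|apply: (conv x _ (S n).1)];
    rewrite ?mul1r ?mulN1r ?ltrN2 in cq qx.
by apply: (linked_between c'q); case: sP c'x xq => ->; lra.
Qed.

Definition committed (s K : R) n :=
  [/\ stage n, X (S n).1, K <= s * (S n).1 & frontier s n].

(** The point [u] provided by [sparse] is unvisited, because it lies beyond the
outermost visited clump, and its distance to the walk is less than the distance
to the origin. The next point cannot be on the inner side: everything down to the
origin is visited. *)
Lemma committed_step (s K : R) n : s = 1 \/ s = -1 -> 0 < K -> sparse r X s K ->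
  committed s K n -> exists n', [/\ (n < n')%N, committed s K n' &
    forall k, (n < k <= n')%N -> 0 < s * (S k).1].
Proof.
move=> sP K0 sp [stn Xc Kc fr].
have [Xq nVq] := stage_next stn; have [hc _ _ _ conv] := stn.
have Vc : V n ((S n).1, 0) by case: hc => [c0|[]//]; rewrite c0 in Xc.
have [u [Xu cu u2 ncu]] := sp _ Kc.
have nVu : ~ V n (u, 0) by move=> Vu; apply: ncu; exact: fr.
have near := stage_nearest stn Xu nVu.
have qc : (S n.+1).1 <> (S n).1 by move=> e; apply: nVq; rewrite e.
have cq : s * (S n).1 < s * (S n.+1).1.
  rewrite ltNge le_eqVlt; apply/negP => /orP[/eqP e|qc'].
    by apply: qc; move: e; case: sP => ->; rewrite ?mul1r ?mulN1r; [|move/oppr_inj].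
  apply: nVq; have hc0 : reached n 0 by left.
  case: sP cu u2 Kc qc' => -> cu u2 Kc qc'.
    move: near; rewrite ler0_norm; last lra; rewrite ger0_norm; last lra.
    by move=> near; apply: (conv 0 _ (S n).1) => //; lra.
  move: near; rewrite ger0_norm; last lra; rewrite ler0_norm; last lra.
  by move=> near; apply: (conv (S n).1 _ 0) => //; lra.
have [n' [nn' stn' inC Vn']] := stage_step stn.
have Cc' := inC n' ltac:(by rewrite nn' leqnn).
exists n'; split=> //; last first.
  by move=> k /inC Ck; have := outward_clump sP stn Xc cq Ck; lra.
split=> //; first exact: Cc'.1.
  by have := outward_clump sP stn Xc cq Cc'; lra.
exact: (outward_frontier sP stn cq Cc' Vn').
Qed.

Lemma committed_forever (s K : R) n0 m : s = 1 \/ s = -1 -> 0 < K -> sparse r X s K ->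
  committed s K n0 -> exists n, [/\ (m <= n)%N, (n0 <= n)%N, committed s K n &
    forall k, (n0 <= k <= n)%N -> 0 < s * (S k).1].
Proof.
move=> sP K0 sp lock0; elim: m => [|m [n [mn n0n lockn pos]]].
  exists n0; split=> // k; rewrite -eqn_leq => /eqP <-.
  by have [_ _ + _] := lock0; lra.
have [n' [nn' lockn' pos']] := committed_step sP K0 sp lockn.
exists n'; split=> //; [exact: leq_ltn_trans nn'|lia|].
move=> k /andP[n0k kn']; have [kn|nk] := leqP k n.
  by apply: pos; rewrite n0k.
by apply: pos'; rewrite nk.
Qed.

Lemma committed_conclusion (s K : R) n0 : s = 1 \/ s = -1 -> 0 < K -> sparse r X s K ->
  committed s K n0 ->
  (forall x l, X x -> 0 < s * x -> [set 0; r] l -> range S (x, l)) /\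
  finite_set [set a | s * a.1 < 0 /\ range S a].
Proof.
move=> sP K0 sp lock0; split.
  move=> x l Xx x0 hl.
  have [m mx] := walk_escapes `|x|.
  have [n [mn n0n [stn Xc Kc _] _]] := committed_forever m sP K0 sp lock0.
  have := mx _ mn; have [hc _ lines _ conv] := stn => xc.
  suff [k _ ek] : V n (x, l) by exists k.
  apply/lines => //; have h0 : reached n 0 by left.
  case: sP x0 Kc => -> x0 Kc.
    move: xc; rewrite !gtr0_norm; try lra.
    by move=> xc; apply: (conv 0 _ (S n).1) => //; lra.
  move: xc; rewrite !ltr0_norm; try lra.
  by move=> xc; apply: (conv (S n).1 _ 0) => //; lra.
apply: (@sub_finite_set _ _ [set S k | k in [set k | (k < n0)%N]]).
  move=> a [a0 [k _ ek]]; exists k => //=; rewrite ltnNge; apply/negP => n0k.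
  have [n [kn _ _ pos]] := committed_forever k sP K0 sp lock0.
  by have := pos k; rewrite n0k kn ek => /(_ isT); lra.
by apply: finite_image; exact: finite_II.
Qed.

(** From a late stage the walk steps in some direction [s], and the next clump lies
beyond the current position in this direction. It cannot lie between the current
position and the origin, where everything has been visited, so it is on the side
[s] of the origin: it is the outermost visited clump there, and it is far out
because the walk has escaped from bounded sets for good. *)
Lemma eventually_committed : exists n, committed 1 Kright n \/ committed (-1) Kleft n.
Proof.
have [m hm] := walk_escapes (Num.max Kright Kleft).
have [n mn stn] := stage_ge (maxn 1 m).
have n0 : (0 < n)%N by move: mn; rewrite geq_max => /andP[].
have {mn} mn : (m <= n)%N by move: mn; rewrite geq_max => /andP[].
have [n' [nn' stn' inC Vn']] := stage_step stn.
have Cc' := inC n' ltac:(by rewrite nn' leqnn).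
have Xc := (walk_mem n0).1.
have [Xq nVq] := stage_next stn; have [hc _ _ sat conv] := stn.
have nVc' : ~ V n ((S n').1, 0).
  by move=> h; apply: nVq; apply: (sat _ _ Cc'.1 Xq h); exact: linked_sym Cc'.2.
have Vc : V n ((S n).1, 0) by case: hc => [c0|[]//]; rewrite c0 in Xc.
have far := hm n' (leq_trans mn (ltnW nn')).
have m1 : Kright <= Num.max Kright Kleft by rewrite le_max lexx.
have m2 : Kleft <= Num.max Kright Kleft by rewrite le_max lexx orbT.
have k1 := Kright_gt0; have k2 := Kleft_gt0.
have h0 : reached n 0 by left.
exists n'; have [cq|qc|qc] := ltgtP (S n).1 (S n.+1).1; last by case: nVq; rewrite -qc.
  have sP : (1 : R) = 1 \/ (1 : R) = -1 by left.
  have cq1 : 1 * (S n).1 < 1 * (S n.+1).1 by rewrite !mul1r.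
  have cc' := outward_clump sP stn Xc cq1 Cc'.
  left; split=> //; [exact: Cc'.1| |exact: (outward_frontier sP stn cq1 Cc' Vn')].
  rewrite mul1r; have [c'0|c'0] := ltP (S n').1 0.
    by case: nVc'; apply: (conv (S n).1 _ 0) => //; [exact: Cc'.1|lra].
  by rewrite ger0_norm in far; lra.
have sP : (-1 : R) = 1 \/ (-1 : R) = -1 by right.
have cq1 : -1 * (S n).1 < -1 * (S n.+1).1 by lra.
have cc' := outward_clump sP stn Xc cq1 Cc'.
right; split=> //; [exact: Cc'.1| |exact: (outward_frontier sP stn cq1 Cc' Vn')].
have [c'0|c'0] := ltP 0 (S n').1.
  by case: nVc'; apply: (conv 0 _ (S n).1) => //; [exact: Cc'.1|lra].
by rewrite ler0_norm in far; lra.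
Qed.

End Walk.

(** * Conclusion for locally finite sets *)

Lemma finite_argmin (R : realType) (T : choiceType) (f : T -> R) (A : set T) :
  finite_set A -> A !=set0 -> exists2 a, A a & forall b, A b -> f a <= f b.
Proof.
move=> /finite_seqP[s ->] /=; elim: s => [[]//|x s IHs] _.
have [/IHs[a /= sa amin]|sE] := pselect ([set` s] !=set0); last first.
  exists x => [|b]; rewrite /= inE ?eqxx// => /orP[/eqP ->//|bs].
  by case: sE; exists b.
have [xa|ax] := leP (f x) (f a); [exists x|exists a]; rewrite /= ?inE ?eqxx ?sa ?orbT//.
  by move=> b /=; rewrite inE => /orP[/eqP ->//|/amin]; exact: le_trans.
by move=> b /=; rewrite inE => /orP[/eqP ->|/amin//]; exact: ltW.
Qed.

Section GreedyWalk.
Variables (R : realType) (r : R) (X : set R).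
Hypothesis r_gt0 : 0 < r.
Hypothesis no_gap_r : forall x y, X x -> X y -> x + r <> y.
Hypothesis X_locfin : forall M : R, finite_set (X `&` [set x | `|x| <= M]).
Hypothesis X_n0 : ~ X 0.
Variables Kright Kleft : R.
Hypothesis Kright_gt0 : 0 < Kright.
Hypothesis Kleft_gt0 : 0 < Kleft.
Hypothesis sparse_right : sparse r X 1 Kright.
Hypothesis sparse_left : sparse r X (-1) Kleft.
Local Notation dist := (@euclid_dist R).
Local Notation Pi := (X `*` [set 0; r]).
Local Notation S := (greedy_walk dist Pi (0, 0)).

Lemma argmin_exists (A : set (R * R)) x : A `<=` Pi -> A !=set0 ->
  argmin_dist dist A x !=set0.
Proof.
move=> APi [a0 Aa0]; pose D := dist a0 x.
have finB : finite_set (A `&` [set a | dist a x <= D]).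
  apply: (@sub_finite_set _ _
      ((X `&` [set z | `|z| <= `|x.1| + D]) `*` [set 0; r])).
    move=> a [Aa aD]; have [Xa la] := APi _ Aa; split=> //; split=> //=.
    have h := le_trans (dist_ge_horizontal a x) aD.
    by rewrite -(subrK x.1 a.1) addrC (le_trans (ler_normD _ _))// lerD2l.
  by apply: finite_setX; [exact: X_locfin|exact: finite_set2].
have [|a [Aa aD] amin] := finite_argmin (dist ^~ x) finB.
  by exists a0; split => //=.
exists a; split=> // z Az; have [zD|Dz] := leP (dist z x) D; first exact: amin.
exact: le_trans aD (ltW Dz).
Qed.

Lemma sparse_unbounded (s K M : R) : s = 1 \/ s = -1 -> sparse r X s K ->
  exists2 u, X u & M < s * u.
Proof.
move=> sP sp; pose c := s * Num.max K M.
have sc : s * c = Num.max K M.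
  by rewrite /c mulrA; case: sP => ->; rewrite ?mulrNN mulr1 mul1r.
have [u [Xu cu _ _]] := sp c ltac:(by rewrite sc le_max lexx).
by exists u => //; apply: le_lt_trans cu; rewrite sc le_max lexx orbT.
Qed.

Lemma greedy_walk_argmin n :
  argmin_dist dist (Pi `\` visited S n) (S n) (S n.+1).
Proof.
rewrite greedy_walkS -/(visited S n).
apply: xgetPex; apply: argmin_exists => [a []//|].
have finV : finite_set (visited S n).
  apply: finite_image; apply: (@sub_finite_set _ _ `I_n.+1); last exact: finite_II.
  by move=> k /=; rewrite ltnS.
have [|b _ bmax] := finite_argmin (fun a => - a.1) finV; first by exists (S 0%N); exists 0%N.
have [u Xu bu] := sparse_unbounded b.1 (or_introl erefl) sparse_right.
exists (u, 0); split; first by split => //; left.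
by move=> /bmax /=; rewrite mul1r in bu; lra.
Qed.

Theorem greedy_walk_one_side :
  let left_side : set (R * R) := [set x | x.1 < 0] in
  let right_side : set (R * R) := [set x | 0 < x.1] in
  ~ (Pi `<=` range S) /\
  ((Pi `&` left_side `<=` range S /\
    finite_set (Pi `&` right_side `&` range S)) \/
   (Pi `&` right_side `<=` range S /\
    finite_set (Pi `&` left_side `&` range S))).
Proof.
move=> left_side right_side.
have concl s K s' K' n : s = 1 \/ s = -1 -> s' = - s -> 0 < K ->
    sparse r X s K -> sparse r X s' K' -> committed r X S s K n ->
  [/\ ~ (Pi `<=` range S), Pi `&` [set a | 0 < s * a.1] `<=` range S
    & finite_set (Pi `&` [set a | s * a.1 < 0] `&` range S)].
  move=> sP es' K0 sp sp' comm.
  have [all fin] := committed_conclusion r_gt0 no_gap_r X_locfin X_n0 Kright_gt0 Kleft_gt0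
    sparse_right sparse_left erefl greedy_walk_argmin sP K0 sp comm.
  have s'P : s' = 1 \/ s' = -1.
    by rewrite es'; case: sP => ->; [right|left; rewrite opprK].
  (* If all points were visited, the finite set of visited points on the opposite
     side would have an outermost one, contrary to [sparse] there. *)
  split; last by apply: sub_finite_set fin => a [[_ a0] ra].
    move=> PiS.
    have [u0 Xu0 u00] := sparse_unbounded 0 s'P sp'.
    have [|a [a0 _] amin] := finite_argmin (fun a => s * a.1) fin.
      exists (u0, 0); split; first by rewrite /= es' in u00 *; lra.
      by apply: PiS; split=> //; left.
    have [u Xu ua] := sparse_unbounded (s' * a.1) s'P sp'.
    rewrite es' in ua.
    have := amin (u, 0); rewrite /= => h.
    suff : s * a.1 <= s * u by lra.
    by apply: h; split; [lra|apply: PiS; split=> //; left].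
  by move=> [x l] [[Xx hl] /= x0]; exact: all.
have [n [comm|comm]] := eventually_committed r_gt0 no_gap_r X_locfin X_n0
  Kright_gt0 Kleft_gt0 sparse_right sparse_left erefl greedy_walk_argmin.
  have [nall h1 h2] := concl _ _ (-1) _ _ (or_introl erefl) erefl Kright_gt0
    sparse_right sparse_left comm.
  split=> //; right; split.
    by move=> a [Pia a0]; apply: h1; split=> //=; rewrite mul1r.
  apply: sub_finite_set h2 => a [[Pia a0] ra]; split=> //; split=> //=.
  by rewrite mul1r.
have [nall h1 h2] := concl _ _ 1 _ _ (or_intror erefl) (esym (opprK _)) Kleft_gt0
  sparse_left sparse_right comm.
split=> //; left; split.
  by move=> a [Pia a0]; apply: h1; split=> //=; rewrite mulN1r oppr_gt0.
apply: sub_finite_set h2 => a [[Pia a0] ra]; split=> //; split=> //=.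
by rewrite mulN1r oppr_lt0.
Qed.

End GreedyWalk.

(** * Null sets *)

Lemma counting_eq0 (T : choiceType) (R : realType) (A : set T) :
  counting A = 0%E :> \bar R <-> A = set0.
Proof.
rewrite /counting; case: asboolP => fA; last first.
  by split=> // A0; case: fA; rewrite A0.
split=> [[/eqP]|->]; last by rewrite fset_set0 finmap.cardfs0.
rewrite pnatr_eq0 finmap.cardfs_eq0 => /eqP h.
by rewrite -(fset_setK fA) h; apply/seteqP; split.
Qed.

Lemma counting_nat_finite (T : choiceType) (R : realType) (A : set T) (k : nat) :
  counting A = k%:R%:E :> \bar R -> finite_set A.
Proof. by rewrite /counting; case: asboolP. Qed.

Section NullSets.
Context d (T : measurableType d) (R : realType) (P : probability T R).

Lemma negligible_le_eps (N : set T) :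
  (forall e : R, 0 < e -> exists A, [/\ measurable A, N `<=` A & (P A <= e%:E)%E]) ->
  P.-negligible N.
Proof.
move=> h.
have {}h (n : nat) : exists A, [/\ measurable A, N `<=` A & (P A <= (n.+1%:R^-1)%:E)%E].
  by apply: h; rewrite invr_gt0.
have [A hA] := choice h.
have mA : measurable (\bigcap_n A n) by apply: bigcapT_measurable => n; have [] := hA n.
exists (\bigcap_n A n); split=> //; last first.
  by move=> x Nx n _; have [_ + _] := hA n; apply.
apply/eqP; rewrite eq_le measure_ge0 andbT.
apply/lee_addgt0Pr => e e0; rewrite add0e.
have [n] := ltr_add_invr (y := 0) (x := e) e0.
rewrite add0r => /ltW ne; apply: (@le_trans _ _ (n.+1%:R^-1)%:E); last by rewrite lee_fin.
have [mAn _ hAn] := hA n; apply: le_trans hAn.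
apply: le_measure; rewrite ?inE//.
exact: bigcap_inf.
Qed.

(** The first Borel-Cantelli lemma, with a geometric series as the majorant. *)
Lemma negligible_lim_sup_geometric (F : (set T)^nat) (q : R) :
  (forall n, measurable (F n)) -> 0 <= q -> q < 1 ->
  (forall n, (P (F n) <= (q ^+ n)%:E)%E) ->
  P.-negligible (lim_sup_set F).
Proof.
move=> mF q0 q1 Fq.
have mL : measurable (lim_sup_set F).
  by apply: bigcapT_measurable => n; apply: bigcup_measurable => k _.
apply/negligibleP => //; apply: lim_sup_set_cvg0 => //.
apply: (@le_lt_trans _ _ ((1 - q)^-1)%:E); last exact: ltry.
apply: lime_le; first exact: is_cvg_nneseries.
apply: nearW => n.
apply: (@le_trans _ _ (\sum_(0 <= i < n) (q ^+ i)%:E)%E).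
  by apply: lee_sum => i _; exact: Fq.
rewrite sumEFin lee_fin.
have -> : \sum_(0 <= i < n) q ^+ i = (1 - q ^+ n) / (1 - q).
  have q_neq1 : q != 1 by rewrite lt_eqF.
  have := congr1 (fun f => f n) (@geometric_seriesE R 1 q q_neq1).
  rewrite /series /= mul1r => <-.
  by apply: eq_bigr => i _; rewrite mul1r.
by rewrite ler_pdivrMr ?subr_gt0// mulVf ?gt_eqF ?subr_gt0// gerBl exprn_ge0.
Qed.

End NullSets.

(** * Poisson processes *)

Section Poisson.
Context d (T : measurableType d) (R : realType) (P : probability T R).
Context (Pihat : T -> set R) (pp : poisson_process P 1 Pihat).

Definition count_in (B : set R) (A : set (\bar R)) : set T :=
  npoints Pihat B @^-1` A.

Lemma measurable_count_in B A : measurable B -> measurable A ->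
  measurable (count_in B A).
Proof.
by move=> mB mA; rewrite -[count_in _ _]setTI; exact: (pp_measurable pp mB).
Qed.

Lemma count_in0 B w : count_in B [set 0%E] w <-> Pihat w `&` B = set0.
Proof. exact: counting_eq0. Qed.

Lemma poisson_prob_void (m : R) : 0 < m -> poisson_prob m 0 [set 0%N] = (expR (- m))%:E.
Proof.
move=> m0; rewrite /poisson_prob m0 esum_set1 ?lee_fin ?poisson_pmf_ge0//.
by rewrite /poisson_pmf m0 expr0 fact0 invr1 !mul1r.
Qed.

Lemma void_law B : measurable B -> (lebesgue_measure B < +oo)%E ->
  P (count_in B [set 0%E]) = poisson_prob (fine (lebesgue_measure B)) 0 [set 0%N].
Proof.
by move=> mB finB; have := pp_law pp mB finB [set 0%N]; rewrite image_set1 mul1r.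
Qed.

Lemma void_interval (a b : R) x y : a < b ->
  P (count_in [set` Interval (BSide x a) (BSide y b)] [set 0%E]) =
  (expR (- (b - a)))%:E.
Proof.
move=> ab; rewrite void_law//; last first.
  by rewrite lebesgue_measure_itv/= lte_fin ab ltry.
by rewrite lebesgue_measure_itv/= lte_fin ab/= poisson_prob_void ?subr_gt0.
Qed.

Lemma ae_avoid_point (a : R) : {ae P, forall w, ~ Pihat w a}.
Proof.
have mE : measurable (count_in [set a] [set 0%E]) by exact: measurable_count_in.
exists (~` count_in [set a] [set 0%E]); split; first exact: measurableC.
  rewrite probability_setC// void_law//; last first.
    by rewrite lebesgue_measure_set1 ltry.
  rewrite lebesgue_measure_set1/= /poisson_prob ltxx diracE mem_set//.
  by rewrite subee.
move=> w /= /contrapT Xa /count_in0 X0.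
by have : (Pihat w `&` [set a]) a by []; rewrite X0.
Qed.

Lemma ae_locally_finite :
  {ae P, forall w, forall M : R, finite_set (Pihat w `&` [set x | `|x| <= M])}.
Proof.
pose B (n : nat) : set R := `[- n%:R, n%:R]%classic.
have mB n : measurable (B n) by exact: measurable_itv.
have finB n : (lebesgue_measure (B n) < +oo)%E.
  by rewrite lebesgue_measure_itv/=; case: ifP => _; rewrite ltry.
have mk : measurable ([set k%:R%:E | k in [set: nat]] : set (\bar R)).
  rewrite (_ : [set _ | _ in _] = \bigcup_k [set (k%:R%:E : \bar R)]).
    by apply: bigcupT_measurable => k.
  by apply/seteqP; split=> [_ [k _ <-]|_ [k _ ->]]; exists k.
pose F n := ~` count_in (B n) [set k%:R%:E | k in [set: nat]].
have : P.-negligible (\bigcup_n F n).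
  apply: negligible_bigcup => n; apply/negligibleP.
    by apply: measurableC; exact: measurable_count_in.
  have mC : measurable (count_in (B n) [set k%:R%:E | k in [set: nat]]).
    exact: measurable_count_in.
  have := probability_setC P mC.
  by rewrite {2}/count_in (pp_law pp)// probability_setT subee.
apply: negligibleS => w /= /existsNP[M nfin].
have [n Mn] : exists n : nat, M <= n%:R.
  exists (Num.bound `|M|); apply: le_trans (ler_norm M) _.
  exact: ltW (archi_boundP (normr_ge0 M)).
exists n => // -[k _ /esym /counting_nat_finite fin]; apply: nfin.
apply: sub_finite_set fin => x [Xx /= xM]; split=> //=.
by rewrite /B /= in_itv/= -ler_norml (le_trans xM).
Qed.

(** Each interval is hit with probability [1 - expR (- h)], at most [h]. *)
Lemma pair_hit (a b h : R) : 0 < h -> a + h <= b ->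
  (P (~` count_in `[a, (a + h)%R[ [set 0%E] `&`
      ~` count_in `[b, (b + h)%R[ [set 0%E]) <= (h ^+ 2)%:E)%E.
Proof.
move=> h0 ab.
pose B (i : 'I_2) : set R := if i == ord0 then `[a, (a + h)[%classic
  else `[b, (b + h)[%classic.
have mB i : measurable (B i) by rewrite /B; case: ifP => _; exact: measurable_itv.
have tB : trivIset setT B.
  move=> i j _ _ [x [Bi Bj]]; apply: contrapT => /eqP ij.
  have : (x \in `[a, (a + h)[) /\ (x \in `[b, (b + h)[).
    move: i j ij Bi Bj; rewrite /B => -[[|[|//]] ?] [[|[|//]] ?] //= _;
      by rewrite /= => ? ?; split.
  by rewrite !in_itv/= => -[/andP[_ h1] /andP[h2 _]]; lra.
have mA (i : 'I_2) : measurable (~` [set 0%E] : set (\bar R)).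
  by apply: measurableC; exact: emeasurable_set1.
have := pp_independent pp mB tB mA.
rewrite !big_ord_recl big_ord0 /= mule1.
rewrite (_ : \bigcap_i _ = ~` count_in `[a, (a + h)%R[ [set 0%E] `&`
      ~` count_in `[b, (b + h)%R[ [set 0%E]); last first.
  apply/seteqP; split=> w /=.
    by move=> hw; split; [exact: (hw ord0)|exact: (hw (lift ord0 ord0))].
  by move=> [h1 h2] [[|[|//]] i] _; rewrite /B /=.
move=> ->.
have hit c : (P (~` count_in `[c, (c + h)%R[ [set 0%E]) <= h%:E)%E.
  rewrite probability_setC; last by apply: measurable_count_in.
  rewrite void_interval; last lra.
  rewrite addrAC subrr add0r -EFinB lee_fin.
  by have := expR_ge1Dx (- h); lra.
rewrite expr2 EFinM; apply: lee_pmul.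
- exact: measure_ge0.
- exact: measure_ge0.
- exact: hit.
- exact: hit.
Qed.

End Poisson.

(** * Almost sure geometry of the process *)

Section Gap.
Context d (T : measurableType d) (R : realType) (P : probability T R).
Context (Pihat : T -> set R) (pp : poisson_process P 1 Pihat).
Variable r : R.
Hypothesis r_gt0 : 0 < r.
Local Notation count_in := (count_in Pihat).

(** In a grid of mesh [h] between [- M] and [M], a point and its translate by [r] hit a cell
and the translate of this cell. There are [2 M / h] cells, each with probability
at most [h ^ 2] by [pair_hit], so the total is at most [2 M h]. *)
Lemma ae_no_gap : {ae P, forall w,
  forall x y, Pihat w x -> Pihat w y -> x + r <> y}.
Proof.
have r0 := r_gt0.
pose Bad (M : nat) := [set w | exists x, [/\ Pihat w x, Pihat w (x + r),
  - M%:R <= x & x < M%:R]].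
suff badN M : P.-negligible (Bad M).
  have := negligible_bigcup badN; apply: negligibleS => w /=.
  move=> /existsNP[x /existsNP[y /not_implyP[Xx /not_implyP[Xy /contrapT xy]]]].
  have xb := archi_boundP (normr_ge0 x).
  exists (Num.bound `|x|) => //; exists x; rewrite xy; split=> //.
    by rewrite lerNl (le_trans _ (ltW xb))// -normrN ler_norm.
  by rewrite (le_lt_trans (ler_norm x)).
apply: negligible_le_eps => e e0.
have [n n1] : exists n : nat, Num.max (r^-1) (2 * M%:R / e) <= n%:R.
  exists (Num.bound `|Num.max (r^-1) (2 * M%:R / e)|).
  exact: le_trans (ler_norm _) (ltW (archi_boundP (normr_ge0 _))).
move: n1; rewrite ge_max => /andP[nr nM].
pose h : R := n.+1%:R^-1.
have h0 : 0 < h by rewrite invr_gt0.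
have hn : h * n.+1%:R = 1 by rewrite mulVf.
have hr : h <= r.
  rewrite -[r]invrK lef_pV2 ?posrE ?invr_gt0//; apply: le_trans nr _.
  by rewrite ler_nat.
pose a k : R := - M%:R + k%:R * h.
pose I k : set R := `[a k, (a k + h)%R[%classic.
pose J k : set R := `[(a k + r)%R, (a k + r + h)%R[%classic.
pose A k := ~` count_in (I k) [set 0%E] `&` ~` count_in (J k) [set 0%E].
have mA k : measurable (A k).
  have mV c : measurable (~` count_in `[c, (c + h)%R[ [set 0%E]).
    apply: measurableC; apply: (measurable_count_in pp); first exact: measurable_itv.
    exact: emeasurable_set1.
  by apply: measurableI; exact: mV.
have PA k : (P (A k) <= (h ^+ 2)%:E)%E by apply: (pair_hit pp) => //; lra.
pose m := (2 * M * n.+1)%N.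
exists (\big[setU/set0]_(k < m) A k); split.
- by apply: bigsetU_measurable => k _.
- move=> w [x [Xx Xxr Mx xM]].
  have xn0 : 0 <= (x + M%:R) * n.+1%:R by apply: mulr_ge0 => //; lra.
  have /andP[k1 k2] := truncn_itv xn0.
  set k := Num.trunc _ in k1 k2.
  have km : (k < m)%N.
    rewrite -(ltr_nat R); apply: le_lt_trans k1 _.
    by rewrite /m natrM ltr_pM2r// natrM; lra.
  have e1 : (x + M%:R) * n.+1%:R * h = x + M%:R.
    by rewrite -mulrA [n.+1%:R * h]mulrC hn mulr1.
  have {k1} k1 : a k <= x.
    have : k%:R * h <= (x + M%:R) * n.+1%:R * h by rewrite ler_pM2r.
    by rewrite e1 /a; lra.
  have {k2} k2 : x < a k + h.
    have : (x + M%:R) * n.+1%:R * h < k.+1%:R * h by rewrite ltr_pM2r.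
    by rewrite e1 /a -natr1; lra.
  apply: (bigsetU_sup km).
  split=> /count_in0 X0.
    have : (Pihat w `&` I k) x by split=> //; rewrite /I /= in_itv/= k1.
    by rewrite X0.
  have : (Pihat w `&` J k) (x + r).
    by split=> //; rewrite /J /= in_itv/=; apply/andP; split; lra.
  by rewrite X0.
- apply: le_trans (Boole_inequality _ _) _; first by move=> i _; exact: mA.
  apply: (@le_trans _ _ (\sum_(i < m) (h ^+ 2)%:E)%E).
    by apply: lee_sum => i _; exact: PA.
  rewrite sumEFin lee_fin sumr_const card_ord -mulr_natl /m natrM expr2.
  rewrite -mulrA [n.+1%:R * _]mulrA [n.+1%:R * h]mulrC hn mul1r natrM.
  have : 2 * M%:R / e <= n.+1%:R by apply: le_trans nM _; rewrite ler_nat.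
  by rewrite ler_pdivrMr// -[leRHS]mulrC -ler_pdivrMr.
Qed.

Definition cell (s : R) (k : nat) : set R :=
  [set z | k%:R * r < s * z /\ s * z < k.+1%:R * r].

Lemma cell_itv s k : s = 1 \/ s = -1 -> exists a b, [/\ a < b, b - a = r &
  cell s k = `]a, b[%classic].
Proof.
have r0 := r_gt0.
have e : k.+1%:R * r = k%:R * r + r by rewrite -natr1 mulrDl mul1r.
case=> ->.
  exists (k%:R * r), (k%:R * r + r); split; [lra|lra|].
  apply/seteqP; split=> z; rewrite /cell /= in_itv/= mul1r e.
    by case=> -> ->.
  by move=> /andP[].
exists (- (k%:R * r + r)), (- (k%:R * r)); split; [lra|lra|].
apply/seteqP; split=> z; rewrite /cell /= in_itv/= mulN1r e.
  by move=> [h1 h2]; apply/andP; split; lra.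
by move=> /andP[h1 h2]; split; lra.
Qed.

Lemma cell_inj s i j z : cell s i z -> cell s j z -> i = j.
Proof.
have le i' j' : i'%:R * r < s * z -> s * z < j'.+1%:R * r -> (i' <= j')%N.
  by move=> h1 /(lt_trans h1); rewrite ltr_pM2r// ltr_nat ltnS.
by move=> [i1 i2] [j1 j2]; apply/eqP; rewrite eqn_leq !le.
Qed.

Lemma measurable_cell s k : s = 1 \/ s = -1 -> measurable (cell s k).
Proof. by move=> /cell_itv-/(_ k)[a [b [_ _ ->]]]; exact: measurable_itv. Qed.

Lemma cell_void_law s k : s = 1 \/ s = -1 ->
  P (count_in (cell s k) [set 0%E]) = (expR (- r))%:E.
Proof.
by move=> /cell_itv-/(_ k)[a [b [ab abr ->]]]; rewrite void_interval// abr.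
Qed.

Definition cells_event s A m n : set T :=
  \bigcap_(i : 'I_n) count_in (cell s (m + i)) A.

Lemma measurable_cells_event s A m n : s = 1 \/ s = -1 -> measurable A ->
  measurable (cells_event s A m n).
Proof.
move=> sP mA; apply: fin_bigcap_measurable; first exact: finite_finset.
by move=> i _; apply: (measurable_count_in pp) => //; exact: measurable_cell.
Qed.

Lemma cells_event_law s A m n (c : R) : s = 1 \/ s = -1 -> measurable A ->
  (forall k, P (count_in (cell s k) A) = c%:E) ->
  P (cells_event s A m n) = (c ^+ n)%:E.
Proof.
move=> sP mA PA.
have tB : trivIset setT (fun i : 'I_n => cell s (m + i)).
  move=> i j _ _ [z [zi zj]]; apply/val_inj/eqP.
  by rewrite -(eqn_add2l m); apply/eqP; exact: cell_inj zi zj.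
have := pp_independent pp (fun i : 'I_n => measurable_cell (m + i) sP) tB
  (fun=> mA).
rewrite /cells_event /count_in => ->.
under eq_bigr do rewrite [P _]PA.
by rewrite prodEFin prodr_const card_ord.
Qed.

(** Both exceptional events, that no cell of a block of [n] is empty and that all
are, have the form [cells_event], with a probability geometric in [n]. *)
Lemma ae_cells s : s = 1 \/ s = -1 -> {ae P, forall w, exists N, forall n,
  (N <= n)%N ->
  (exists2 k, (4 * n <= k < 5 * n)%N & forall z, Pihat w z -> ~ cell s k z) /\
  (exists2 k, (5 * n <= k < 6 * n)%N & exists2 z, Pihat w z & cell s k z)}.
Proof.
move=> sP; have r0 := r_gt0.
have m0 : measurable ([set 0%E] : set (\bar R)) by exact: emeasurable_set1.
pose F n := cells_event s (~` [set 0%E]) (4 * n) n.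
pose G n := cells_event s [set 0%E] (5 * n) n.
have v0 : 0 < expR (- r) by exact: expR_gt0.
have v1 : expR (- r) < 1 by rewrite expR_lt1; lra.
have PF n : (P (F n) <= ((1 - expR (- r)) ^+ n)%:E)%E.
  rewrite (cells_event_law _ _ (c := 1 - expR (- r))) //; first exact: measurableC.
  move=> k; rewrite /count_in -preimage_setC probability_setC.
    by rewrite [P _](cell_void_law k sP) EFinB.
  by apply: (measurable_count_in pp) => //; exact: measurable_cell.
have PG n : (P (G n) <= (expR (- r) ^+ n)%:E)%E.
  by rewrite (cells_event_law _ _ (c := expR (- r))) // => k; exact: cell_void_law.
have mF n : measurable (F n) by apply: measurable_cells_event => //; exact: measurableC.
have mG n : measurable (G n) by exact: measurable_cells_event.
have nF : P.-negligible (lim_sup_set F).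
  by apply: (negligible_lim_sup_geometric mF _ _ PF); lra.
have nG : P.-negligible (lim_sup_set G).
  by apply: (negligible_lim_sup_geometric mG _ _ PG); lra.
apply: negligibleS (negligibleU nF nG) => w /= nw.
apply: contrapT => /not_orP[/existsNP[N1 nF1] /existsNP[N2 nG2]].
apply: nw; exists (maxn N1 N2) => n; rewrite geq_max => /andP[N1n N2n]; split.
  apply: contrapT => h; apply: nF1 => _; exists n => // i _ /=.
  rewrite /count_in /= => /counting_eq0 X0.
  apply: h; exists (4 * n + i)%N; first by have := ltn_ord i; lia.
  move=> z Xz cz; have : (Pihat w `&` cell s (4 * n + i)) z by [].
  by rewrite X0.
apply: contrapT => h; apply: nG2 => _; exists n => // i _.
apply/count_in0/seteqP; split=> // z [Xz cz]; apply: h.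
by exists (5 * n + i)%N; [have := ltn_ord i; lia|exists z].
Qed.

(** If [4 p r <= s c < 4 (p + 1) r], the cells from [4 (p + 1)] on lie beyond [c], and
those before [6 (p + 1)] end at most at [6 (p + 1) r], which is below [8 p r] and
hence below [2 s c] for [p >= 4]. This is where the factors [4], [5], [6] of the
blocks and the [N + 4] in [K] come from. *)
Lemma cells_sparse (X : set R) s : s = 1 \/ s = -1 ->
  (exists N, forall n, (N <= n)%N ->
  (exists2 k, (4 * n <= k < 5 * n)%N & forall z, X z -> ~ cell s k z) /\
  (exists2 k, (5 * n <= k < 6 * n)%N & exists2 z, X z & cell s k z)) ->
  exists2 K, 0 < K & sparse r X s K.
Proof.
move=> sP [N hN]; have r0 := r_gt0.
exists (4 * (N + 4)%:R * r); first by rewrite !mulr_gt0// ltr0n addn4.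
move=> c Kc.
have sc0 : 0 <= s * c by apply: le_trans Kc; rewrite !mulr_ge0// ltW.
have c0 : 0 <= s * c / (4 * r) by apply: divr_ge0 => //; lra.
have /andP[] := truncn_itv c0.
set p := Num.trunc _ => p1 p2.
have r4 : 0 < 4 * r by lra.
rewrite ler_pdivlMr// in p1; rewrite ltr_pdivrMr// in p2.
have pN : (N + 4 <= p)%N.
  rewrite -ltnS -(ltr_nat R) -(ltr_pM2r r4); lra.
have [[k /andP[k1 k2] kvoid] [j /andP[j1 j2] [u Xu [u1 u2]]]] := hN p.+1 ltac:(lia).
have k1r : (4 * p.+1)%:R * r <= k%:R * r by rewrite ler_pM2r// ler_nat.
have k2r : k.+1%:R * r <= j%:R * r by rewrite ler_pM2r// ler_nat; lia.
have j2r : j.+1%:R * r <= (6 * p.+1)%:R * r by rewrite ler_pM2r// ler_nat.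
have p4r : 4 * r <= p%:R * r by rewrite ler_pM2r// ler_nat; lia.
rewrite natrM -[p.+1%:R]natr1 mulrDr mulrDl in k1r.
rewrite [(6 * _)%:R]natrM -[p.+1%:R]natr1 mulrDr mulrDl in j2r.
rewrite -[p.+1%:R]natr1 mulrDl mul1r in p2.
exists u; split=> //; [lra|lra|] => uc.
have ek : k.+1%:R * r = k%:R * r + r by rewrite -natr1 mulrDl mul1r.
rewrite /cell ek in kvoid.
case: sP kvoid k1r k2r u1 u2 p1 p2 => -> kvoid k1r k2r u1 u2 p1 p2.
  have vk : empty_gap r X (k%:R * r) by move=> z Xz *; apply: (kvoid z Xz) => /=; lra.
  by have [/(_ ltac:(lra)) + _] := uc _ vk; lra.
have vk : empty_gap r X (- (k%:R * r + r)).
  by move=> z Xz *; apply: (kvoid z Xz) => /=; lra.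
by have [_ /(_ ltac:(lra))] := uc _ vk; lra.
Qed.

End Gap.

(** * The theorem *)

Theorem theorem2 (R : realType) (d : measure_display) (T : measurableType d)
    (P : probability T R) (r : R) (r_gt0 : 0 < r)
    (Pihat : T -> set R) (Pihat_poisson : poisson_process P 1 Pihat) :
  {ae P, forall w : T,
    let Pi : set (R * R) := Pihat w `*` [set 0; r] in
    let S := greedy_walk (@euclid_dist R) Pi (0, 0) in
    let left_side : set (R * R) := [set x | x.1 < 0] in
    let right_side : set (R * R) := [set x | 0 < x.1] in
    ~ (Pi `<=` range S) /\
    ((Pi `&` left_side `<=` range S /\
      finite_set (Pi `&` right_side `&` range S)) \/
     (Pi `&` right_side `<=` range S /\
      finite_set (Pi `&` left_side `&` range S)))}.
Proof.
have sr : (1 : R) = 1 \/ (1 : R) = -1 by left.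
have sl : (-1 : R) = 1 \/ (-1 : R) = -1 by right.
have fP : Filter (nbhs (almost_everywhere P)) := ae_filter_ringOfSetsType P.
pose ae_and := @filterI _ _ fP.
have good := ae_and _ _ (ae_no_gap Pihat_poisson r_gt0)
  (ae_and _ _ (ae_locally_finite Pihat_poisson)
  (ae_and _ _ (ae_avoid_point Pihat_poisson 0)
  (ae_and _ _ (ae_cells Pihat_poisson r_gt0 sr)
              (ae_cells Pihat_poisson r_gt0 sl)))).
apply: (@filterS _ _ fP _ _ _ good) => w.
move=> [no_gap [locfin [avoid0 [cells_r cells_l]]]].
have [K1 K1_gt0 sparse_r] := cells_sparse r_gt0 sr cells_r.
have [K2 K2_gt0 sparse_l] := cells_sparse r_gt0 sl cells_l.
exact: (greedy_walk_one_side r_gt0 no_gap locfin avoid0 K1_gt0 K2_gt0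
  sparse_r sparse_l).
Qed.
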